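(* Let $m\ge 2$ and $n\ge 1$ be integers. Let $\operatorname{TSRP}(m,n,2)$ be the set of primitive TSR matrices of order $n$ over $\mathbb{F}_{2^m}$ and let $P_2(m,n)$ be the set of primitive polynomials of degree $n$ in $\mathbb{F}_{2^m}[X]$ of the form $X^n-\mu g(X)$, where $\mu$ is a primitive element of $\mathbb{F}_{2^m}$ and $g(X)\in\mathbb{F}_2[X]$ with $g(0)=1$ and $\deg g\le n-1$. Then $$|\operatorname{TSRP}(m,n,2)| = \frac{|P_2(m,n)|}{m}\cdot\frac{|\mathbb{GL}_m(\mathbb{F}_2)|}{2^m-1}.$$
   Context: A polynomial of degree $d$ over a finite field $\mathbb{F}_Q$ is primitive if it is monic and irreducible and one (equivalently every) root generates $\mathbb{F}_{Q^d}^*$; an element of $\mathbb{F}_{2^m}$ is primitive if it generates $\mathbb{F}_{2^m}^*$. A TSR matrix of order $n$ over $\mathbb{F}_{2^m}$ is an $mn\times mn$ block matrix over $\mathbb{F}_2$ with $m\times m$ blocks of the form $$T=\begin{pmatrix} \mathbf{0} & \mathbf{0} & \cdots & \mathbf{0} & c_0A\\ I_m & \mathbf{0} & \cdots & \mathbf{0} & c_1A\\ \mathbf{0} & I_m & \cdots & \mathbf{0} & c_2A\\ \vdots & & \ddots & & \vdots\\ \mathbf{0} & \mathbf{0} & \cdots & I_m & c_{n-1}A\end{pmatrix},$$ with $c_0,\dots,c_{n-1}\in\mathbb{F}_2$ and $A\in M_m(\mathbb{F}_2)$. It is primitive if $\det(XI_{mn}-T)\in\mathbb{F}_2[X]$ is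 a primitive polynomial of degree $mn$ over $\mathbb{F}_2$; $\operatorname{TSRP}(m,n,2)$ is the set of all such primitive matrices. $\mathbb{GL}_m(\mathbb{F}_2)$ is the group of invertible $m\times m$ matrices over $\mathbb{F}_2$. *)

(* Defs.v *)
From mathcomp Require Import all_boot all_order all_algebra all_fingroup.
From mathcomp Require Import all_solvable all_field.

Set Implicit Arguments.
Unset Strict Implicit.
Unset Printing Implicit Defensive.

Import GRing.Theory.
Local Open Scope ring_scope.

Definition primitive_elt (F : finFieldType) (x : F) : bool :=
  [exists u : {unit F}, (FinRing.uval u == x) && generator [set: {unit F}] u].

Section PrimitivePolyRoots.

Variables (F L : finFieldType) (f : {rmorphism F -> L}).
Variables (p : {poly F}) (x : L).
Hypotheses (p_monic : p \is monic) (p_irr : irreducible_poly p).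
Hypotheses (px0 : root (map_poly f p) x) (cardL : #|L| = (#|F| ^ (size p).-1)%N).

Lemma dvdp_rootE (q : {poly F}) : (p %| q) = root (map_poly f q) x.
Proof.
apply/idP/idP => [pq|qx]; first by apply: root_dvdp px0; rewrite dvdp_map.
apply: contraTT qx; rewrite -(irreducible_poly_coprime _ p_irr) => cpq.
by rewrite rootE; apply: coprimep_root px0; rewrite coprimep_map.
Qed.

Lemma dvdp_Xn_sub1E k : (p %| 'X^k - 1) = (x ^+ k == 1).
Proof.
by rewrite dvdp_rootE rmorphB /= map_polyXn rmorph1 rootE !hornerE subr_eq0.
Qed.

Lemma primitive_poly_root : primitive_poly p = primitive_elt x.
Proof.
have cardq : #|{poly %/ p}| = #|L|.
  by rewrite card_monic_qpoly ?cardL //; case: p_irr.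
have cardU : #|[set: {unit L}]| = #|L|.-1.
  rewrite cardsT card_sub -(cardC1 (0 : L)).
  by apply: eq_card => y; rewrite !inE unitfE.
have L_gt0 : (0 < #|L|.-1)%N by rewrite -cardU cardG_gt0.
apply/primitive_polyP/existsP => [|[u /andP[/eqP ux gu]]] /=; rewrite cardq.
  move=> [_ xv1 min_v].
  have Ux : x \is a GRing.unit.
    rewrite unitfE; apply/eqP => x0; move: xv1.
    by rewrite dvdp_Xn_sub1E x0 expr0n eqn0Ngt L_gt0 eq_sym oner_eq0.
  exists (FinRing.unit L Ux); rewrite eqxx /= /generator eq_sym eqEcard subsetT.
  rewrite cardU -/(order _) leqNgt; apply/negP => lt_o.
  have /min_v : (0 < #[FinRing.unit L Ux]%g < #|L|.-1)%N.
    by rewrite order_gt0 lt_o.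
  have /(congr1 val)/= := expg_order (FinRing.unit L Ux).
  by rewrite FinRing.val_unitX /= dvdp_Xn_sub1E => ->; rewrite eqxx.
have ou : #[u]%g = #|L|.-1 by rewrite -cardU (eqP gu).
have xE k : (x ^+ k == 1) = (#|L|.-1 %| k)%N.
  by rewrite -ux -FinRing.val_unitX -ou order_dvdn -val_eqE.
split=> [|| k /andP[k0 kv]]; first exact: (p_irr, p_monic).
  by rewrite dvdp_Xn_sub1E xE dvdnn.
by rewrite dvdp_Xn_sub1E xE gtnNdvd.
Qed.

End PrimitivePolyRoots.

(* [primitive_poly] is stated through the order of 'X modulo p; this is the   *)
(* reading in terms of a root of p in the extension of degree d = deg p.      *)
Lemma primitive_poly_exists_root (F : finFieldType) (p : {poly F}) :
  primitive_poly p <->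
  [/\ p \is monic, irreducible_poly p &
      exists (L : finFieldType) (f : {rmorphism F -> L}) (x : L),
        [/\ #|L| = (#|F| ^ (size p).-1)%N, root (map_poly f p) x
          & primitive_elt x]].
Proof.
split=> [pp|[pm pI [L [f [x [cL px gx]]]]]]; last first.
  by rewrite (primitive_poly_root pm pI px cL).
have [[pI pm] _ _] := primitive_polyP _ pp; split=> //.
pose mi : monic_irreducible_poly p := (pI, pm).
pose L : finFieldType := {poly %/ p with mi}.
pose f : {rmorphism F -> L} := in_alg L.
pose x : L := 'qX.
have fE : map_poly f p = map_poly (qpolyC p) p.
  apply: eq_map_poly => a; rewrite /f /=; apply/val_inj => /=.
  by rewrite alg_polyC.
have px : root (map_poly f p) x.
  rewrite rootE fE /x -(in_qpoly_comp_horner p p 'X) comp_polyXr.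
  apply/eqP; apply: (@val_inj _ _ {poly %/ p}).
  by rewrite /= mk_monicE // Pdiv.RingMonic.rmodpp.
have cL : #|L| = (#|F| ^ (size p).-1)%N by rewrite card_qfpoly.
by exists L, f, x; split=> //; rewrite -(primitive_poly_root pm pI px cL).
Qed.

Definition tsr_block m n (c : {ffun 'I_n -> 'F_2}) (A : 'M['F_2]_m)
    (i j : 'I_n) : 'M['F_2]_m :=
  if j.+1 == n then c i *: A else if i == j.+1 :> nat then 1%:M else 0.

(* The dimension [\sum_(i < n) m] is the one [\mxblock] assigns to n blocks of *)
(* size m; it is provably, not definitionally, equal to m * n.                 *)
Definition tsr_mx m n (c : {ffun 'I_n -> 'F_2}) (A : 'M['F_2]_m) :
    'M['F_2]_(\sum_(i < n) m) :=
  \mxblock_(i < n, j < n) tsr_block c A i j.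

Definition TSRP2 m n : {set 'M['F_2]_(\sum_(i < n) m)} :=
  [set T | [exists c : {ffun 'I_n -> 'F_2}, exists A : 'M['F_2]_m,
              T == tsr_mx c A]
           & primitive_poly (char_poly T)].

(* 'F_2 is represented by the naturals {0, 1}; in characteristic 2 the cast    *)
(* below is the inclusion of the prime field.                                  *)
Definition of_F2 (F : nzRingType) (a : 'F_2) : F := (a : nat)%:R.

(* {poly_k R} is the finite type of polynomials p with size p <= k, i.e. of    *)
(* degree less than k.                                                         *)
Definition P2 (F : finFieldType) n : {set {poly_n.+1 F}} :=
  [set p : {poly_n.+1 F} |
     [&& size p == n.+1, primitive_poly p &
         [exists mu : F, exists g : {poly_n 'F_2},
            [&& primitive_elt mu, g.[0] == 1 &
                polyn p == 'X^n - mu *: map_poly (of_F2 F) g]]]].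

(* Main.v *)
From HB Require Import structures.
Require Import Defs.
From mathcomp Require Import all_boot all_order all_algebra all_fingroup.
From mathcomp Require Import all_solvable all_field.

(* Write g = \sum_i c_i X^i. Eliminating block rows gives
     char_poly T = \det (X^n - g A) = \sum_i h_i X^(n i) g^(m - i)
   with h = char_poly A, so char_poly T depends on A only through h. If a in
   F_(2^m) is a root of h and x a root of X^n - a g, then x is also a root of
   char_poly T, and comparing the order of x with the size of the field it lives
   in shows that char_poly T is primitive over F_2 iff X^n - a g is primitive
   over F_(2^m). For a fixed g, count the pairs (A, a) with a a root of
   char_poly A: every admissible A has exactly m roots a, and every admissible
   a, having an irreducible minimal polynomial h of degree m, comes from the
   matrices with characteristic polynomial h. There are |GL_m| / (2^m - 1) of
   them, because (A, v) |-> (v, v A, ..., v A^(m-1)), v != 0, is a bijection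
   onto GL_m. *)

Set Implicit Arguments.
Unset Strict Implicit.
Unset Printing Implicit Defensive.

Import GRing.Theory Num.Theory.
Local Open Scope ring_scope.

(** * Primitive elements and irreducible polynomials over finite fields *)

Lemma primitive_elt_neq0 (L : finFieldType) (x : L) : primitive_elt x -> x != 0.
Proof. by case/existsP=> u /andP[/eqP<- _]; rewrite -unitfE (valP u). Qed.

Lemma primitive_eltP (L : finFieldType) (x : L) :
  x != 0 -> reflect (forall k, x ^+ k = 1 -> (#|L|.-1 %| k)%N) (primitive_elt x).
Proof.
move=> x0; have Ux : x \is a GRing.unit by rewrite unitfE.
have cU := card_finField_unit L.
have xE k : (x ^+ k == 1) = (#[FinRing.unit L Ux]%g %| k)%N.
  by rewrite order_dvdn -val_eqE /= FinRing.val_unitX.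
apply: (iffP existsP) => [[u /andP[/eqP ux gu]] k /eqP|gx].
  have -> : (x ^+ k == 1) = (#[u]%g %| k)%N.
    by rewrite order_dvdn -val_eqE /= FinRing.val_unitX -ux.
  by rewrite /order -(eqP gu) cU.
exists (FinRing.unit L Ux); rewrite eqxx /= /generator eq_sym eqEcard subsetT.
rewrite cU -/(order _) dvdn_leq ?order_gt0 //; apply: gx.
by apply/eqP; rewrite xE.
Qed.

Lemma exists_monic_irreducible_factor (K : finFieldType) (p : {poly K}) :
  (1 < size p)%N ->
  exists q, [/\ q \is monic, irreducible_poly q & q %| p].
Proof.
have [k] := ubnP (size p); elim: k p => // k IHk p; rewrite ltnS => sp p_gt1.
have p0 : p != 0 by rewrite -size_poly_gt0 (ltn_trans _ p_gt1).
have [/irreducibleP p_irr|/negP] := boolP (irreducibleb p).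
  have lp0 : (lead_coef p)^-1 != 0 by rewrite invr_eq0 lead_coef_eq0.
  exists ((lead_coef p)^-1 *: p); rewrite dvdpZl ?dvdpp //; split=> //.
    by rewrite monicE lead_coefZ mulVf // lead_coef_eq0.
  split=> [|q sq]; first by rewrite size_scale.
  rewrite dvdpZr // => /(p_irr.2 _ sq) /eqp_trans->//.
  by rewrite eqp_sym eqp_scale.
(* A proper factor is searched for in the finite type of polynomials of smaller size, where its
   existence is decidable. *)
move=> p_red; case: (boolP
  [exists q : {poly_(size p).-1 K}, (1 < size q)%N && (q %| p)]).
  case/existsP=> q /andP[q_gt1 qp].
  have sq := size_npoly q.
  have [||r [r_mon r_irr rq]] := IHk q => //.
    by apply: leq_ltn_trans sq _; rewrite prednK // (ltn_trans _ p_gt1).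
  by exists r; split=> //; apply: dvdp_trans qp.
move=> /existsPn no; case: p_red; apply/irreducibleP; split=> // q sq qp.
rewrite -dvdp_size_eqp // eqn_leq dvdp_leq //= leqNgt; apply/negP => lt_q.
have q0 : q != 0 by apply: contraNneq p0 => q0; move: qp; rewrite q0 dvd0p.
have sq' : (size q <= (size p).-1)%N by rewrite -ltnS prednK // (ltn_trans _ p_gt1).
have := no (npolyp _ q); rewrite npolypK // qp andbT ltn_neqAle eq_sym sq.
by rewrite size_poly_gt0 q0.
Qed.

(** Irreducible factors not vanishing at x are divided out of p one by one; x remains a root of the
    quotient, whose size decreases. *)
Lemma exists_monic_irreducible_root (K L : finFieldType) (f : {rmorphism K -> L})
    (p : {poly K}) (x : L) : p != 0 -> root (map_poly f p) x ->
  exists q, [/\ q \is monic, irreducible_poly q, q %| p & root (map_poly f q) x].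
Proof.
have [k] := ubnP (size p); elim: k p => // k IHk p; rewrite ltnS => sp p0 px.
have p_gt1 : (1 < size p)%N.
  by rewrite -(size_map_poly f) (@root_size_gt1 _ x) ?map_poly_eq0.
have [q [q_mon q_irr qp]] := exists_monic_irreducible_factor p_gt1.
have [qx|Nqx] := boolP (root (map_poly f q) x); first by exists q.
move: (p %/ q) (divpK qp) => r rq.
have r0 : r != 0 by apply: contraNneq p0 => r0; rewrite -rq r0 mul0r.
have [|||s [s_mon s_irr sr sx]] := IHk r => //.
- apply: leq_trans sp; rewrite -rq size_mul ?(monic_neq0 q_mon) //.
  by have := q_irr.1; case: (size q) => [|[|d]] // _; rewrite !addnS /= ltnS leq_addr.
- by move: px; rewrite -rq rmorphM /= rootM (negPf Nqx) orbF.
by exists s; split=> //; rewrite -rq dvdp_mulr.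
Qed.

Lemma monic_irreducible_qfpoly (K : finFieldType) (p : {poly K}) :
  p \is monic -> irreducible_poly p ->
  exists (L : finFieldType) (f : {rmorphism K -> L}) (x : L),
    #|L| = (#|K| ^ (size p).-1)%N /\ root (map_poly f p) x.
Proof.
move=> p_mon p_irr; pose mi : monic_irreducible_poly p := (p_irr, p_mon).
pose L : finFieldType := {poly %/ p with mi}.
pose f : {rmorphism K -> L} := in_alg L.
pose x : L := 'qX; exists L, f, x; split; first by rewrite card_qfpoly.
have fE : map_poly f p = map_poly (qpolyC p) p.
  by apply: eq_map_poly => a; apply/val_inj; rewrite /= alg_polyC.
rewrite rootE fE /x -(in_qpoly_comp_horner p p 'X) comp_polyXr.
apply/eqP; apply: (@val_inj _ _ {poly %/ p}).
by rewrite /= mk_monicE // Pdiv.RingMonic.rmodpp.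
Qed.

(** In the field K[X]/(q), of cardinality #|K|^(deg q), the class of X is a root of q fixed by the
    power map of that exponent. *)
Lemma irreducible_dvdp_Xcard_subX (K : finFieldType) (q : {poly K}) :
  q \is monic -> irreducible_poly q -> q %| 'X^(#|K| ^ (size q).-1) - 'X.
Proof.
move=> q_mon q_irr.
have [L [f [y [cL qy]]]] := monic_irreducible_qfpoly q_mon q_irr.
rewrite (dvdp_rootE q_irr qy) rmorphB /= map_polyXn map_polyX -cL.
by rewrite rootE !hornerE expf_card subrr.
Qed.

Lemma irreducible_root_expf_card (K L : finFieldType) (f : {rmorphism K -> L})
    (q : {poly K}) (x : L) : q \is monic -> irreducible_poly q ->
  root (map_poly f q) x -> x ^+ (#|K| ^ (size q).-1) = x.
Proof.
move=> q_mon q_irr qx; have := irreducible_dvdp_Xcard_subX q_mon q_irr.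
rewrite (dvdp_rootE q_irr qx) rmorphB /= map_polyXn map_polyX.
by rewrite rootE !hornerE subr_eq0 => /eqP.
Qed.

(** An irreducible factor q of p vanishes at x, so the order of x, which is #|L| - 1, divides
    #|K|^(deg q) - 1. *)
Lemma primitive_root_card_le (K L : finFieldType) (f : {rmorphism K -> L})
    (p : {poly K}) (x : L) : primitive_elt x -> p != 0 ->
  root (map_poly f p) x -> (#|L| <= #|K| ^ (size p).-1)%N.
Proof.
move=> gx p0 px; have x0 := primitive_elt_neq0 gx.
have [q [q_mon q_irr qp qx]] := exists_monic_irreducible_root p0 px.
have q_gt1 := q_irr.1; have K_gt1 := finNzRing_gt1 K.
have d_gt0 : (0 < (size q).-1)%N by rewrite -ltnS prednK // ltnW.
apply: (@leq_trans (#|K| ^ (size q).-1)); last first.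
  by rewrite leq_exp2l // -!subn1 leq_sub2r // dvdp_leq.
have N_gt1 : (1 < #|K| ^ (size q).-1)%N by rewrite -(exp1n (size q).-1) ltn_exp2r.
have := irreducible_root_expf_card q_mon q_irr qx.
move: N_gt1; case: (_ ^ _)%N => // -[|N] // _.
rewrite exprS -[RHS]mulr1 => /(mulfI x0).
move/(primitive_eltP x0): gx => gx /gx /dvdn_leq -/(_ isT).
by rewrite -ltnS prednK // ltnW // finNzRing_gt1.
Qed.

(** Irreducibility comes from the preceding bound: the irreducible factor of p that vanishes at x
    has degree at least deg p, hence is p. *)
Lemma primitive_poly_of_root (K L : finFieldType) (f : {rmorphism K -> L})
    (p : {poly K}) (x : L) : p \is monic -> root (map_poly f p) x ->
  #|L| = (#|K| ^ (size p).-1)%N -> primitive_elt x -> primitive_poly p.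
Proof.
move=> p_mon px cL gx; have p0 := monic_neq0 p_mon.
have [q [q_mon q_irr qp qx]] := exists_monic_irreducible_root p0 px.
have := primitive_root_card_le gx (monic_neq0 q_mon) qx.
rewrite cL leq_exp2l ?finNzRing_gt1 // => le_pq.
have p_gt0 : (0 < size p)%N by rewrite size_poly_gt0.
have q_gt0 : (0 < size q)%N by rewrite ltnW // q_irr.1.
have eq_pq : p = q.
  apply/eqP; rewrite eq_sym -eqp_monic // -dvdp_size_eqp // eqn_leq dvdp_leq //=.
  by rewrite -(prednK p_gt0) -(prednK q_gt0) ltnS.
by rewrite (primitive_poly_root p_mon _ px cL) // eq_pq.
Qed.

(** The order of X modulo p is #|K|^(deg p) - 1, while x^(#|L| - 1) = 1 makes p divide X^(#|L| - 1)
    - 1. *)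
Lemma primitive_poly_card_le (K L : finFieldType) (f : {rmorphism K -> L})
    (p : {poly K}) (x : L) : primitive_poly p -> root (map_poly f p) x ->
  (#|K| ^ (size p).-1 <= #|L|)%N.
Proof.
case/primitive_polyP=> -[p_irr p_mon]; rewrite card_monic_qpoly ?p_irr.1 //.
move=> pX min_p px; have K_gt1 := finNzRing_gt1 K; have L_gt1 := finNzRing_gt1 L.
have d_gt0 : (0 < (size p).-1)%N by rewrite -ltnS prednK ?p_irr.1 // ltnW ?p_irr.1.
have N_gt1 : (1 < #|K| ^ (size p).-1)%N by rewrite -(exp1n (size p).-1) ltn_exp2r.
have x0 : x != 0.
  apply/eqP => x0; move: pX; rewrite (dvdp_Xn_sub1E p_irr px) x0 expr0n.
  by rewrite eqn0Ngt -subn1 subn_gt0 N_gt1 eq_sym oner_eq0.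
have xL : p %| 'X^(#|L|.-1) - 1.
  rewrite (dvdp_Xn_sub1E p_irr px); apply/eqP/(mulfI x0).
  by rewrite mulr1 -exprS prednK ?expf_card // ltnW.
rewrite leqNgt; apply/negP => lt_L.
have /min_p/negP[]// : (0 < #|L|.-1 < (#|K| ^ (size p).-1).-1)%N.
by rewrite !ltn_predRL L_gt1 prednK // ltnW.
Qed.

(** Over F, h divides X^#|F| - X, the product of the distinct factors X - a, so it splits with
    simple roots. *)
Lemma card_irreducible_roots (K F : finFieldType) (f : {rmorphism K -> F})
    (h : {poly K}) : h \is monic -> irreducible_poly h ->
  #|F| = (#|K| ^ (size h).-1)%N ->
  #|[set a : F | root (map_poly f h) a]| = (size h).-1.
Proof.
move=> h_mon h_irr cF.
have := irreducible_dvdp_Xcard_subX h_mon h_irr.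
rewrite -(dvdp_map f) rmorphB /= map_polyXn map_polyX -cF finField_genPoly.
rewrite -big_enum /= => /dvdp_prod_XsubC[b eq_h].
have /eqP eh : map_poly f h == \prod_(i <- mask b (enum F)) ('X - i%:P).
  by rewrite -eqp_monic ?monic_prod_XsubC ?map_monic.
rewrite -(size_map_poly f) eh size_prod_XsubC /=.
rewrite -(card_uniqP (mask_uniq (enum_uniq F) b)).
by apply: eq_card => a; rewrite inE root_prod_XsubC.
Qed.

(** Primitivity of a bounds deg h from below by m. For the upper bound, evaluation at a is injective
    on polynomials of degree less than deg h, so #|K|^(deg h) is at most #|F|. *)
Lemma exists_minimal_polynomial (K F : finFieldType) (f : {rmorphism K -> F})
    m (a : F) : (0 < m)%N -> #|F| = (#|K| ^ m)%N -> primitive_elt a ->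
  exists h, [/\ h \is monic, irreducible_poly h, size h = m.+1
               & root (map_poly f h) a].
Proof.
move=> m_gt0 cF ga; have F_gt1 := finNzRing_gt1 F.
have X0 : 'X^#|F| - 'X != 0 :> {poly K}.
  rewrite -size_poly_gt0 size_polyDl ?size_polyXn // size_polyN size_polyX.
  by rewrite ltnS.
have [|h [h_mon h_irr _ ha]] := exists_monic_irreducible_root (f := f) (x := a) X0.
  by rewrite rmorphB /= map_polyXn map_polyX rootE !hornerE expf_card subrr.
exists h; split=> //; have h_gt0 : (0 < size h)%N by rewrite size_poly_gt0 monic_neq0.
have := primitive_root_card_le ga (monic_neq0 h_mon) ha.
rewrite cF leq_exp2l ?finNzRing_gt1 // => le_m.
apply/eqP; rewrite -(prednK h_gt0) eqSS eqn_leq le_m andbT.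
rewrite -(leq_exp2l _ _ (finNzRing_gt1 K)) -cF -card_npoly.
rewrite -(@card_imset _ _ (fun p : {poly_(size h).-1 K} => (map_poly f p).[a])).
  exact: max_card.
move=> p q /eqP; rewrite -subr_eq0 -hornerN -hornerD -rmorphB -rootE.
rewrite -(dvdp_rootE h_irr ha) => hpq; apply/val_inj/eqP; rewrite -subr_eq0.
apply: contraTT hpq => pq0; apply/negP => /(dvdp_leq pq0).
apply/negP; rewrite -ltnNge -[X in (_ < X)%N](prednK h_gt0) ltnS.
by rewrite (leq_trans (size_polyD _ _)) // size_polyN geq_max !size_npoly.
Qed.

Lemma irreducible_root_unique (K F : finFieldType) (f : {rmorphism K -> F})
    (h h' : {poly K}) (a : F) : irreducible_poly h -> h \is monic ->
  h' \is monic -> size h' = size h -> root (map_poly f h) a ->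
  root (map_poly f h') a -> h' = h.
Proof.
move=> h_irr h_mon h'_mon eq_s ha h'a; apply/eqP; rewrite eq_sym -eqp_monic //.
by rewrite -dvdp_size_eqp ?eq_s // (dvdp_rootE h_irr ha).
Qed.

(** #|F| is a power of the characteristic shared by F and L, so the power map is additive, and it
    fixes the coefficients, which come from F. *)
Lemma horner_expf_card (F L : finFieldType) (f : {rmorphism F -> L})
    (p : {poly F}) (y : L) :
  (map_poly f p).[y ^+ #|F|] = (map_poly f p).[y] ^+ #|F|.
Proof.
have [r r_pr rF] := finPcharP F.
have FE : [pchar L].-nat #|F|.
  have := rmorph_pchar f rF => rL; rewrite (eq_pnat _ (pcharf_eq rL)).
  by have := abelem_pgroup (pprimeChar_abelem rF); rewrite /pgroup cardsT.
rewrite !horner_coef size_map_poly.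
have F_gt0 : (0 < #|F|)%N by rewrite ltnW ?finNzRing_gt1.
pose e (z : L) := z ^+ #|F|.
rewrite -[RHS]/(e _) (big_morph e (id1 := 0) (op1 := +%R)); last 2 first.
- by move=> u v; apply: exprDn_pchar.
- by rewrite /e expr0n eqn0Ngt F_gt0.
apply: eq_bigr => i _; rewrite /e exprMn coef_map -rmorphXn expf_card.
by rewrite -!exprM mulnC.
Qed.

(** Up to sign the constant coefficient is the norm of a root x, the product of its conjugates
    x^(Q^i). It equals x^S with S = 1 + Q + ... + Q^(n-1), and the norm of a generator is a
    generator. *)
Lemma primitive_poly_coef0 (F : finFieldType) (p : {poly F}) :
  primitive_poly p -> primitive_elt ((-1) ^+ (size p).-1 * p`_0).
Proof.
move=> /primitive_poly_exists_root[p_mon p_irr [L [f [x [cL px gx]]]]].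
have F_gt1 := finNzRing_gt1 F; set Q := #|F| in F_gt1 cL *.
set n := (size p).-1 in cL *; have x0 := primitive_elt_neq0 gx.
have n_gt0 : (0 < n)%N by have := p_irr.1; rewrite /n; case: (size p) => [|[]].
(* The conjugates of x are distinct: if two coincided, Q^n - 1 would divide some Q^j - Q^i, which is
   positive and smaller. *)
pose s := [seq x ^+ (Q ^ i) | i <- index_iota 0 n].
have s_uniq : uniq s.
  rewrite map_inj_in_uniq ?iota_uniq // => i j; rewrite !mem_index_iota /=.
  wlog lt_ij : i j / (i < j)%N => [wl|] i_n j_n e.
    by have [/wl|/wl/(_ j_n i_n (esym e))|] := ltngtP i j; auto.
  have QQ : (Q ^ i < Q ^ j)%N by rewrite ltn_exp2l.
  have : x ^+ (Q ^ j - Q ^ i) = 1.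
    by apply: (mulfI (expf_neq0 (Q ^ i) x0)); rewrite -exprD subnKC ?mulr1 // ltnW.
  move/(primitive_eltP x0): gx => gx /gx /dvdn_leq; rewrite subn_gt0 => /(_ QQ).
  rewrite cL leqNgt; case/negP; rewrite ltn_predRL.
  apply: (@leq_ltn_trans (Q ^ j)); first by rewrite ltn_subrL !expn_gt0 ltnW.
  by rewrite ltn_exp2l.
have s_root : all (root (map_poly f p)) s.
  apply/allP => _ /mapP[i _ ->]; elim: i => [|i IHi]; first by rewrite expn0 expr1.
  rewrite expnSr exprM rootE horner_expf_card (eqP IHi) expr0n.
  by rewrite eqn0Ngt (ltnW F_gt1).
have sp : size (map_poly f p) = (size s).+1.
  by rewrite size_map_poly size_map size_iota subn0 /n prednK // ltnW // p_irr.1.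
have := all_roots_prod_XsubC sp s_root; rewrite uniq_rootsE => /(_ s_uniq).
rewrite (monicP (_ : map_poly f p \is monic)) ?map_monic // scale1r => eq_p.
pose S := (\sum_(i < n) Q ^ i)%N.
have fa : f ((-1) ^+ n * p`_0) = x ^+ S.
  rewrite rmorphM rmorphXn rmorphN1 -coef_map eq_p -horner_coef0 horner_prod.
  rewrite big_map big_mkord.
  under eq_bigr do rewrite hornerXsubC sub0r.
  by rewrite prodrN card_ord mulrA -exprMn mulrNN mulr1 expr1n mul1r prodrXr.
have S_gt0 : (0 < S)%N by rewrite /S (bigD1 (Ordinal n_gt0)) //= expn0.
have a0 : (-1) ^+ n * p`_0 != 0 by rewrite -(fmorph_eq0 f) fa expf_neq0.
apply/(primitive_eltP a0) => k /(congr1 f); rewrite rmorphXn /= fa rmorph1 -exprM.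
move/(primitive_eltP x0): gx => gx /gx.
(* Q^n - 1 = (Q - 1) S, and the factor S cancels. *)
by rewrite cL predn_exp -/S mulnC dvdn_pmul2l.
Qed.

(** * The characteristic polynomial of a TSR matrix as an m x m determinant *)

Lemma det_castmx_diag (R : comNzRingType) n n' (e : n = n') (A : 'M[R]_n) :
  \det (castmx (e, e) A) = \det A.
Proof. by case: n' / e; rewrite castmx_id. Qed.

Lemma det_mx0 (R : comNzRingType) n (A : 'M[R]_n) : n = 0%N -> \det A = 1.
Proof. by move=> n0; move: A; rewrite n0 => A; rewrite det_mx00. Qed.

(** The shape of X - T. The last column takes precedence over the diagonal, so [B n] must itself
    contain the diagonal term. Indices are naturals so that an induction can shift [B] freely. *)
Definition last_col_block (R : comNzRingType) m n (x : R) (B : nat -> 'M[R]_m)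
    (i j : nat) : 'M[R]_m :=
  if j == n then B i else
  if i == j then x%:M else if i == j.+1 then - 1%:M else 0.

Lemma det_last_col_block (K : fieldType) m n (x : K) (B : nat -> 'M[K]_m) :
  x != 0 ->
  \det (\mxblock_(i < n.+1, j < n.+1) last_col_block n x B i j) =
  \det (\sum_(i < n.+1) x ^+ i *: B i).
Proof.
move=> x0; elim: n B => [|n IHn] B.
  rewrite mxblock_recul det_castmx_diag /=.
  rewrite big_ord1 expr0 scale1r /last_col_block /=.
  set E := \mxblock_(i, j) _; set C := \mxcol_i _; set D := \mxrow_j _.
  have -> : C = 0 by apply/mxcolP => -[].
  rewrite det_ublock; rewrite (@det_mx0 _ _ E) ?mulr1 //.
  by rewrite big_ord0.
rewrite mxblock_recul det_castmx_diag /last_col_block /=.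
(* Schur complement of the first block, which is the invertible x%:M; it has *)
(* again the shape of last_col_block. *)
set C := \mxcol_i _; set D := \mxrow_j _; set E := \mxblock_(i, j) _.
have -> : block_mx x%:M D C E = block_mx 1%:M 0 (C *m x^-1%:M) 1%:M *m
    block_mx x%:M D 0 (E - C *m x^-1%:M *m D).
  rewrite mulmx_block !mul1mx !mul0mx !addr0.
  by rewrite -mulmxA -scalar_mxM mulVf // mulmx1 addrC subrK.
rewrite det_mulmx det_lblock !det1 !mul1r det_ublock det_scalar.
(* The elimination adds x^-1 [B 0] to [B 1], the first block of the remaining last column, and
   shifts the other blocks. *)
pose B' k := if k == 0%N then B 1%N + x^-1 *: B 0%N else B k.+1.
have -> : E - C *m x^-1%:M *m D =
    \mxblock_(i < n.+1, j < n.+1) last_col_block n x B' i j.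
  rewrite mxcol_mul mul_mxcol_mxrow -mxblockB; apply: eq_mxblock => i j.
  rewrite /last_col_block /B' /bump /= !add1n !eqSS.
  case: (i : nat) => [|k] /=; rewrite ?mulNmx ?mul0mx ?subr0 //.
  rewrite mul1mx mul_scalar_mx opprK; case: (j == n :> nat) => //.
  by rewrite scaler0 addr0.
(* The determinant x^m of the eliminated block multiplies the m x m sum by x, which restores the
   exponents of x. *)
rewrite IHn -detZ; congr (\det _).
rewrite scaler_sumr big_ord_recl [RHS]big_ord_recl big_ord_recl /= /B' /=.
rewrite !expr0 !scale1r scalerDr !scalerA mulfV // scale1r expr1 addrCA addrA.
congr (_ + _); apply: eq_bigr => i _.
by rewrite scalerA -exprS.
Qed.

Lemma map_mxblock (R S : Type) (f : R -> S) p q (p_ : 'I_p -> nat)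
    (q_ : 'I_q -> nat)
    (B : forall i j, 'M[R]_(p_ i, q_ j)) :
  map_mx f (\mxblock_(i, j) B i j) = \mxblock_(i, j) map_mx f (B i j).
Proof. by apply/matrixP => i j; rewrite !mxE. Qed.

(** With d = deg h this is w^d h(u / w), written without division so that u and w may be
    polynomials. *)
Definition homog (R : comNzRingType) (u w : R) (h : {poly R}) : R :=
  \sum_(i < size h) h`_i * u ^+ i * w ^+ ((size h).-1 - i).

Lemma homogE (R : comNzRingType) (u w a : R) (h : {poly R}) : u = a * w ->
  homog u w h = w ^+ (size h).-1 * h.[a].
Proof.
move=> ->; rewrite /homog horner_coef mulr_sumr; apply: eq_bigr => i _.
have le_i : (i <= (size h).-1)%N.
  by case: (size h) i => [[]|n i] //=; rewrite -ltnS.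
by rewrite exprMn mulrA -mulrA -exprD subnKC // mulrC.
Qed.

Lemma rmorph_homog (R S : comNzRingType) (f : {rmorphism R -> S}) (u w : R)
    (h : {poly R}) : size (map_poly f h) = size h ->
  f (homog u w h) = homog (f u) (f w) (map_poly f h).
Proof.
move=> sh; rewrite /homog rmorph_sum sh; apply: eq_bigr => i _.
by rewrite !rmorphM !rmorphXn coef_map.
Qed.

Lemma horner_char_poly (R : comNzRingType) n (A : 'M[R]_n) (a : R) :
  (char_poly A).[a] = \det (a%:M - A).
Proof.
rewrite -horner_evalE -det_map_mx; congr (\det _); apply/matrixP => i j.
by rewrite !mxE /= horner_evalE hornerD hornerN hornerC hornerMn hornerX.
Qed.

Lemma homog_char_poly (K : fieldType) m (A : 'M[K]_m) (u w : K) : w != 0 ->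
  homog u w (char_poly A) = \det (u%:M - w *: A).
Proof.
move=> w0; rewrite (@homogE _ _ _ (u / w)) ?divfK //.
rewrite size_char_poly horner_char_poly -detZ scalerBr; congr (\det (_ - _)).
by rewrite scale_scalar_mx mulrCA mulfV // mulr1.
Qed.

Definition tap_poly n (c : {ffun 'I_n -> 'F_2}) : {poly 'F_2} :=
  \sum_(i < n) c i *: 'X^i.

(** Block elimination divides by X, hence the passage to the fraction field of [{poly 'F_2}]. *)
Lemma char_poly_tsr_mx m n (c : {ffun 'I_n -> 'F_2}) (A : 'M['F_2]_m) :
  (0 < n)%N ->
  char_poly (tsr_mx c A) =
  \det ('X^n%:M - tap_poly c *: map_mx polyC A).
Proof.
case: n c => // n c _.
pose f : {rmorphism {poly 'F_2} -> {fraction {poly 'F_2}}} :=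
  @tofrac {poly 'F_2}.
apply/eqP; rewrite -tofrac_eq -/f -!det_map_mx /=; apply/eqP.
pose A' := map_mx f (map_mx polyC A).
(* Last block column of X - T: the taps contribute -c_k A, and the bottom block also carries X. *)
pose B k := (if k == n then (f 'X)%:M else 0) - f (c (inord k))%:P *: A'.
have -> : map_mx f (char_poly_mx (tsr_mx c A)) =
    \mxblock_(i < n.+1, j < n.+1) last_col_block n (f 'X) B i j.
  rewrite /char_poly_mx map_mxB map_scalar_mx /tsr_mx -mxdiagZ /mxdiag.
  rewrite !map_mxblock -mxblockB; apply: eq_mxblock => i j.
  rewrite conform_mx_id /tsr_block /last_col_block /B inord_val eqSS.
  rewrite -(val_eqE i j) /=; case: (nat_of_ord j =P n) => [->|_].
    by rewrite !map_mxZ.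
  case: (nat_of_ord i =P j) => [->|_].
    by rewrite ltn_eqF // !map_mx0 subr0.
  by case: eqP => _; rewrite ?map_mx0 ?subr0 // !map_scalar_mx !rmorph1 sub0r.
rewrite det_last_col_block ?tofrac_eq0 ?polyX_eq0 //; congr (\det _).
rewrite map_mxB map_mxZ map_scalar_mx.
under eq_bigr do rewrite scalerBr.
rewrite sumrB; congr (_ - _).
  rewrite (bigD1 ord_max) //= eqxx big1 ?addr0 => [|i ni].
    by rewrite scale_scalar_mx -exprSr /f tofracXn.
  by rewrite ifN ?scaler0.
rewrite /tap_poly rmorph_sum scaler_suml; apply: eq_bigr => i _.
by rewrite scalerA inord_val -mul_polyC rmorphM /f /= tofracXn mulrC.
Qed.

(** * Matrices with a prescribed irreducible characteristic polynomial *)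

Lemma exists_companion (K : fieldType) m (h : {poly K}) :
  h \is monic -> size h = m.+1 ->
  exists C : 'M[K]_m, [/\ char_poly C = h,
    forall i j : 'I_m, i.+1 = j -> row i C = delta_mx 0 j
    & forall i : 'I_m, i.+1 = m -> row i C = \row_j - h`_j].
Proof.
move=> h_mon sh; have e : (size h).-1 = m by rewrite sh.
case: m / e sh => _; exists (companionmx h); split; first exact: companionmxK.
  move=> i j ij; apply/rowP => k; rewrite !mxE eqxx /= ltn_eqF.
    by rewrite -(val_eqE k j) /= ij eq_sym.
  by rewrite ltn_predRL ij ltn_ord.
move=> i im; apply/rowP => k; rewrite !mxE; case: eqP => // -[].
by rewrite -[in RHS]im.
Qed.

Lemma char_poly_conj (K : fieldType) m (P C : 'M[K]_m) : P \in unitmx ->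
  char_poly (invmx P *m C *m P) = char_poly C.
Proof.
move=> uP; rewrite /char_poly /char_poly_mx !map_mxM.
have VP : map_mx polyC (invmx P) *m map_mx polyC P = 1%:M.
  by rewrite -map_mxM mulVmx // map_mx1.
have XE : ('X%:M : 'M[{poly K}]_m) =
    map_mx polyC (invmx P) *m 'X%:M *m map_mx polyC P.
  by rewrite scalar_mxC -mulmxA VP mulmx1.
rewrite [X in X - _ *m _]XE -mulmxBl -mulmxBr !det_mulmx.
by rewrite mulrAC -det_mulmx VP det1 mul1r.
Qed.

Section CountCharPoly.

Variables (K : finFieldType) (m : nat) (h : {poly K}).
Hypotheses (h_mon : h \is monic) (h_irr : irreducible_poly h).
Hypothesis (sh : size h = m.+2).
Local Notation n := m.+1.

Definition krylov_mx (Av : 'M[K]_n * 'rV[K]_n) : 'M[K]_n :=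
  \matrix_(i < n) (Av.2 *m Av.1 ^+ i).

Lemma mulmx_krylov A v (u : 'rV_n) :
  u *m krylov_mx (A, v) = v *m horner_mx A (rVpoly u).
Proof.
rewrite mulmx_sum_row [rVpoly u]poly_def linear_sum mulmx_sumr; apply: eq_bigr => i _.
by rewrite valK /= linearZ rmorphXn /= horner_mx_X rowK -scalemxAr.
Qed.

(** A left kernel vector u, read as a polynomial of degree less than n, satisfies v u(A) = 0. If u
    is nonzero it is coprime to h; as h(A) = 0, a Bezout relation makes u(A) invertible, so v =
    0. *)
Lemma krylov_unitmx A v : char_poly A = h -> v != 0 -> krylov_mx (A, v) \in unitmx.
Proof.
move=> hA v0; rewrite -row_free_unit -kermx_eq0; apply/rowV0P => u /sub_kermxP.
rewrite mulmx_krylov => vu; apply: contraNeq v0 => u0.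
have : coprimep h (rVpoly u).
  rewrite irreducible_poly_coprime //; apply: contraNN u0 => hu.
  have su : (size (rVpoly u) <= n)%N by apply: size_poly.
  rewrite -(rVpolyK u); apply/eqP; suff -> : rVpoly u = 0 by rewrite linear0.
  apply: contraTeq hu => q0; apply: contraL su => hu.
  by rewrite -ltnNge (leq_trans _ (dvdp_leq q0 hu)) // sh.
case/Bezout_coprimepP=> -[a b] /= /eqpP[[c d] /= /andP[c0 d0] eab].
have := congr1 (fun q => v *m horner_mx A q) eab.
rewrite !linearZ /= rmorphD !rmorphM /= -hA Cayley_Hamilton mulr0 add0r rmorph1.
rewrite -?scalemxAr (comm_horner_mx2 A b) mulmxA vu mul0mx scaler0 mulmx1.
by move/esym/eqP; rewrite scaler_eq0 (negPf d0).
Qed.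

(** Multiplication by A shifts the rows v A^i, and Cayley-Hamilton expresses v A^n through them.
    Since the Krylov matrix is invertible for v nonzero, it determines A. *)
Lemma krylov_mulmx A v C :
    (forall i j : 'I_n, i.+1 = j -> row i C = delta_mx 0 j) ->
    (forall i : 'I_n, i.+1 = n -> row i C = \row_j - h`_j) ->
  char_poly A = h -> krylov_mx (A, v) *m A = C *m krylov_mx (A, v).
Proof.
move=> C1 C2 hA; apply/row_matrixP => i; rewrite !row_mul rowK /=.
have [i_n|] := ltnP i.+1 n.
  by rewrite (C1 i (Ordinal i_n)) // -rowE rowK /= -mulmxA mulmxE -exprSr.
move=> le_i; have ei : i.+1 = n by apply/eqP; rewrite eqn_leq le_i andbT.
rewrite (C2 i ei) mulmx_krylov -mulmxA mulmxE -exprSr ei; congr (_ *m _).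
have := Cayley_Hamilton A; rewrite hA.
(* The last row of the companion matrix holds the coefficients of X^n - h. *)
have -> : h = 'X^n - rVpoly (\row_(j < n) - h`_j).
  apply/polyP=> k; rewrite coefB coefXn coef_rVpoly; case: insubP => [j kn jk|].
    by rewrite mxE jk opprK ltn_eqF // add0r.
  rewrite -leqNgt subr0 leq_eqVlt => /orP[/eqP<-|nk].
    by rewrite eqxx; move: h_mon; rewrite monicE lead_coefE sh => /eqP.
  by rewrite gtn_eqF // nth_default // sh.
rewrite rmorphB rmorphXn /= horner_mx_X => /eqP; rewrite subr_eq0 => /eqP->.
congr (horner_mx A _); congr rVpoly; apply/rowP => j; rewrite !mxE.
by rewrite coefB coefXn ltn_eqF // coef_rVpoly_ord mxE opprK add0r.
Qed.

Lemma card_char_poly_eq :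
  (#|[set A : 'M[K]_n | char_poly A == h]| * (#|K| ^ n).-1)%N =
  #|[set P : 'M[K]_n | P \in unitmx]|.
Proof.
have [C [hC C1 C2]] := exists_companion h_mon sh.
pose D := setX [set A : 'M[K]_n | char_poly A == h] [set~ 0 : 'rV[K]_n].
have row0_krylov A v : row 0 (krylov_mx (A, v)) = v by rewrite rowK mulmx1.
have -> : [set P : 'M[K]_n | P \in unitmx] = krylov_mx @: D.
  apply/setP=> P; rewrite inE; apply/idP/imsetP => [uP|[[A v]]]; last first.
    by rewrite !inE /= => /andP[/eqP hA v0] ->; apply: krylov_unitmx.
  (* With e_i C = e_(i+1), conjugating C by P makes row 0 of P run through all the rows of P. *)
  exists (invmx P *m C *m P, row 0 P).
    rewrite !inE /= char_poly_conj // hC eqxx /=.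
    apply: contraTneq uP => P0; rewrite unitmxE unitfE negbK.
    rewrite (expand_det_row _ 0) big1 // => j _.
    by move/rowP/(_ j): P0; rewrite !mxE => ->; rewrite mul0r.
  apply/row_matrixP => -[i ltin]; rewrite rowK /=.
  elim: i ltin => [|i IHi] ltin.
    by rewrite mulmx1; congr (row _ P); apply: val_inj.
  have ltin' := ltnW ltin.
  rewrite exprSr -mulmxE mulmxA -(IHi ltin') [in RHS]rowE !mulmxA mulmxK //.
  by rewrite -rowE (C1 _ (Ordinal ltin)) // -rowE.
rewrite card_in_imset; last first.
  move=> [A v] [A' v']; rewrite !inE /= => /andP[/eqP hA v0] /andP[/eqP hA' _] eqP.
  have eqv : v = v' by rewrite -(row0_krylov A v) eqP row0_krylov.
  congr (_, _) => //; apply: (can_inj (mulKmx (krylov_unitmx hA v0))).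
  by rewrite (krylov_mulmx v C1 C2 hA) eqP (krylov_mulmx v' C1 C2 hA').
by rewrite cardsX cardsC1 card_mx mul1n.
Qed.

End CountCharPoly.

(** * Homogenization by X^n and g, and the polynomials X^n - a g *)

Lemma char_poly_tsr_homog m n (c : {ffun 'I_n -> 'F_2}) (A : 'M['F_2]_m) :
  (0 < n)%N -> tap_poly c != 0 ->
  char_poly (tsr_mx c A) = homog 'X^n (tap_poly c) (map_poly polyC (char_poly A)).
Proof.
move=> n_gt0 g0; rewrite char_poly_tsr_mx //; apply/eqP.
pose f : {rmorphism {poly 'F_2} -> {fraction {poly 'F_2}}} :=
  @tofrac {poly 'F_2}.
rewrite -tofrac_eq -/f; apply/eqP; rewrite -det_map_mx rmorph_homog; last first.
  by rewrite -map_poly_comp !size_map_poly.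
rewrite !map_char_poly homog_char_poly ?tofrac_eq0 //.
by rewrite map_mxB map_mxZ map_scalar_mx.
Qed.

Section Homogenization.

Variables (n : nat) (c : {ffun 'I_n -> 'F_2}).
Hypotheses (n_gt0 : (0 < n)%N) (g0 : tap_poly c != 0).

Definition tap_homog (h : {poly 'F_2}) : {poly 'F_2} :=
  homog 'X^n (tap_poly c) (map_poly polyC h).

(** In the fraction field the homogenization of h is g^(deg h) h(X^n / g), and both factors are
    multiplicative in h. *)
Lemma tap_homogM h q : h != 0 -> q != 0 ->
  tap_homog (h * q) = tap_homog h * tap_homog q.
Proof.
move=> h0 q0.
pose f : {rmorphism {poly 'F_2} -> {fraction {poly 'F_2}}} :=
  @tofrac {poly 'F_2}.
have fE r : f (tap_homog r) =
    f (tap_poly c) ^+ (size r).-1 *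
    (map_poly (f \o polyC) r).[f 'X^n / f (tap_poly c)].
  rewrite rmorph_homog; last by rewrite -map_poly_comp !size_map_poly.
  rewrite (@homogE _ _ _ (f 'X^n / f (tap_poly c))) ?divfK ?tofrac_eq0 //.
  by rewrite -map_poly_comp size_map_poly.
apply/eqP; rewrite -tofrac_eq -/f; apply/eqP; rewrite rmorphM /= !fE rmorphM hornerM.
rewrite mulrACA -exprD size_mul //; congr (_ ^+ _ * _).
move: h0 q0; rewrite -!size_poly_gt0.
by case: (size h) (size q) => [|s] [|t] // _ _; rewrite addnS addSn.
Qed.

(** The homogenization is the characteristic polynomial of the TSR matrix built on a companion
    matrix of h, which is monic of known degree. *)
Lemma tap_homog_monic h : h \is monic ->
  tap_homog h \is monic /\ size (tap_homog h) = (n * (size h).-1).+1.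
Proof.
move=> h_mon; have h_gt0 : (0 < size h)%N by rewrite size_poly_gt0 monic_neq0.
have [C [hC _ _]] := exists_companion h_mon (esym (prednK h_gt0)).
rewrite /tap_homog -hC -char_poly_tsr_homog //; split; first exact: char_poly_monic.
by rewrite !size_char_poly sum_nat_const card_ord.
Qed.

(** An irreducible factor q of h yields a factor of the homogenization of degree n deg q > 0.
    Irreducibility forces n deg q = n deg h, hence q = h. *)
Lemma irreducible_tap_homog h : h \is monic -> (1 < size h)%N ->
  irreducible_poly (tap_homog h) -> irreducible_poly h.
Proof.
move=> h_mon h_gt1 [_ H_irr].
have [q [q_mon q_irr qh]] := exists_monic_irreducible_factor h_gt1.
have r0 : h %/ q != 0 by rewrite dvdp_div_eq0 // monic_neq0.
have [Hq_mon Hq_size] := tap_homog_monic q_mon.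
have [H_mon H_size] := tap_homog_monic h_mon.
have : tap_homog q %= tap_homog h.
  apply: H_irr; last by rewrite -(divpK qh) tap_homogM ?dvdp_mulIr // monic_neq0.
  rewrite Hq_size eqSS muln_eq0 negb_or -!lt0n n_gt0 -ltnS.
  by rewrite prednK ?q_irr.1 // ltnW // q_irr.1.
move/eqp_size; rewrite Hq_size H_size => /eqP; rewrite eqSS eqn_pmul2l // => /eqP e.
suff -> : h = q by [].
apply/eqP; rewrite eq_sym -eqp_monic // -dvdp_size_eqp //.
by rewrite -[size q]prednK ?e ?prednK // ltnW // q_irr.1.
Qed.

Variables (F : finFieldType) (iota : {rmorphism 'F_2 -> F}).

Definition tap_pencil (a : F) : {poly F} :=
  'X^n - a *: map_poly iota (tap_poly c).

Lemma size_tap_poly : (size (tap_poly c) <= n)%N.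
Proof.
apply: leq_trans (size_sum _ _ _) _; apply/bigmax_leqP => i _.
by rewrite (leq_trans (size_scale_leq _ _)) // size_polyXn.
Qed.

Lemma tap_pencil_monic a : tap_pencil a \is monic /\ size (tap_pencil a) = n.+1.
Proof.
have s : (size (a *: map_poly iota (tap_poly c))%R < size ('X^n : {poly F})%R)%N.
  rewrite size_polyXn ltnS (leq_trans (size_scale_leq _ _)) // size_map_poly.
  exact: size_tap_poly.
split; last by rewrite size_polyDl ?size_polyN // size_polyXn.
by rewrite monicE lead_coefDl ?size_polyN // lead_coefXn.
Qed.

(** At x one has x^n = a g(x), so the homogenization takes the value g(x)^(deg h) h(a) = 0. *)
Lemma tap_homog_root (L : finFieldType) (f : {rmorphism F -> L}) h a x :
  root (map_poly iota h) a -> root (map_poly f (tap_pencil a)) x ->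
  root (map_poly (f \o iota) (tap_homog h)) x.
Proof.
move=> ha; rewrite rootE rmorphB /= map_polyXn map_polyZ !hornerE subr_eq0 => /eqP xE.
pose psi : {rmorphism {poly 'F_2} -> L} := horner_eval x \o map_poly (f \o iota).
have psiC : psi \o polyC =1 f \o iota.
  by move=> b; rewrite /psi /= horner_evalE map_polyC hornerC.
have eh : map_poly psi (map_poly polyC h) = map_poly f (map_poly iota h).
  by rewrite -!map_poly_comp; apply: eq_map_poly.
rewrite rootE -horner_evalE -[horner_eval _ _]/(psi _) rmorph_homog; last first.
  by rewrite eh !size_map_poly.
rewrite (@homogE _ _ _ (f a)); last first.
  by rewrite /psi /= !horner_evalE map_polyXn !hornerE xE map_poly_comp.
by rewrite eh horner_map (eqP ha) rmorph0 mulr0.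
Qed.

Lemma primitive_tap_homogE m h a : (0 < m)%N -> #|F| = (2 ^ m)%N ->
  h \is monic -> size h = m.+1 -> root (map_poly iota h) a ->
  primitive_poly (tap_homog h) = primitive_poly (tap_pencil a).
Proof.
move=> m_gt0 cF h_mon sh ha.
have [p_mon p_size] := tap_pencil_monic a.
have [H_mon H_size] := tap_homog_monic h_mon.
have c2 : #|'F_2| = 2%N by rewrite card_Fp.
have cFn : (#|F| ^ n = #|'F_2| ^ (size (tap_homog h)).-1)%N.
  by rewrite H_size sh cF c2 /= mulnC expnM.
apply/idP/idP => [H_prim|p_prim].
  (* A root x of an irreducible factor q of the pencil is also a root of the primitive
     homogenization, so its field has at least #|F|^n elements and q is the whole pencil. *)
  have [|q [q_mon q_irr qp]] := @exists_monic_irreducible_factor _ (tap_pencil a).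
    by rewrite p_size.
  have [L [f [x [cL qx]]]] := monic_irreducible_qfpoly q_mon q_irr.
  have px : root (map_poly f (tap_pencil a)) x by rewrite -(dvdp_rootE q_irr qx).
  have Hx := tap_homog_root ha px.
  have := primitive_poly_card_le H_prim Hx.
  rewrite -cFn cL leq_exp2l ?finNzRing_gt1 // => le_n.
  have q_gt0 : (0 < size q)%N by rewrite ltnW // q_irr.1.
  have eq_pq : q = tap_pencil a.
    apply/eqP; rewrite -eqp_monic // -dvdp_size_eqp // eqn_leq dvdp_leq ?monic_neq0 //=.
    by rewrite p_size -(prednK q_gt0).
  apply: (primitive_poly_of_root p_mon px); first by rewrite cL eq_pq.
  have [[H_irr _] _ _] := primitive_polyP _ H_prim.
  rewrite -(primitive_poly_root H_mon H_irr Hx) //.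
  by rewrite cL -cFn eq_pq p_size.
have [_ _ [L [f [x [cL px gx]]]]] := (primitive_poly_exists_root _).1 p_prim.
apply: (primitive_poly_of_root H_mon (tap_homog_root ha px)) => //.
by rewrite cL p_size -cFn.
Qed.

End Homogenization.

(** * The parameters c and A of a primitive TSR matrix *)

Lemma F2_neq0 (b : 'F_2) : b != 0 -> b = 1.
Proof. by case: b => -[|[|//]] // lt_b _; apply: val_inj. Qed.

(** [P2] is stated with a bare function, while the lemmas on [map_poly] require a morphism. *)
Lemma of_F2_rmorphism (F : nzRingType) : 2%N \in [pchar F] ->
  exists iota : {rmorphism 'F_2 -> F}, iota =1 of_F2 F.
Proof.
move=> F2; have F11 : 1 + 1 = 0 :> F by rewrite -[1 + 1]/(2%:R) pcharf0.
have add_morph : nmod_morphism (of_F2 F).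
  split=> // -[[|[|//]] i] [[|[|//]] j] //=;
  by rewrite /of_F2 /= ?add0r ?addr0 ?F11.
have mul_morph : monoid_morphism (of_F2 F).
  split=> // -[[|[|//]] i] [[|[|//]] j] //=;
  by rewrite /of_F2 /= ?mul0r ?mulr0 ?mulr1.
pose a := GRing.isNmodMorphism.Build _ _ (of_F2 F) add_morph.
pose b := GRing.isMonoidMorphism.Build _ _ (of_F2 F) mul_morph.
pose iota : {rmorphism 'F_2 -> F} := HB.pack (of_F2 F) a b.
by exists iota.
Qed.

Lemma coef_tap_poly n (c : {ffun 'I_n -> 'F_2}) (i : 'I_n) : (tap_poly c)`_i = c i.
Proof.
rewrite coef_sum (bigD1 i) //= coefZ coefXn eqxx mulr1 big1 ?addr0 // => j ji.
by rewrite coefZ coefXn (inj_eq val_inj) eq_sym (negPf ji) mulr0.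
Qed.

Lemma tap_polyK n (g : {poly 'F_2}) : (size g <= n)%N ->
  tap_poly [ffun i : 'I_n => g`_i] = g.
Proof.
move=> sg; rewrite -[RHS](poly_rV_K sg); apply/polyP=> k.
have [k_n|n_k] := ltnP k n.
  by rewrite (coef_tap_poly _ (Ordinal k_n)) ffunE poly_rV_K.
rewrite !nth_default // ?size_poly_rV ?poly_rV_K ?(leq_trans sg) //.
by rewrite (leq_trans (size_tap_poly _)).
Qed.

(** A primitive polynomial has a nonzero constant coefficient, which here is the determinant of -c_0
    A. *)
Lemma primitive_tsr_mx m n (n_gt0 : (0 < n)%N) (c : {ffun 'I_n -> 'F_2})
    (A : 'M['F_2]_m) : (0 < m)%N -> primitive_poly (char_poly (tsr_mx c A)) ->
  c (Ordinal n_gt0) = 1 /\ A != 0.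
Proof.
move=> m_gt0 /primitive_poly_coef0/primitive_elt_neq0.
rewrite mulf_eq0 negb_or => /andP[_]; rewrite char_poly_tsr_mx //.
rewrite -horner_coef0 -horner_evalE -det_map_mx map_mxB map_mxZ map_scalar_mx.
rewrite /= !horner_evalE hornerXn expr0n eqn0Ngt n_gt0 horner_coef0.
rewrite (coef_tap_poly c (Ordinal n_gt0)) -map_mx_comp.
have -> : map_mx (horner_eval 0 \o polyC) A = A.
  by rewrite map_mx_id // => a; rewrite /= horner_evalE hornerC.
move=> det0; have cA0 : c (Ordinal n_gt0) *: A != 0.
  apply: contraNneq det0 => ->; rewrite raddf0 subr0.
  by rewrite -(prednK m_gt0) det0.
move: cA0; rewrite scaler_eq0 negb_or => /andP[c0 A0]; split=> //.
exact: F2_neq0.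
Qed.

(** The last block column lists the c_i A: its first block gives A, and A being nonzero the others
    give the c_i. Counting matrices thus becomes counting pairs (c, A). *)
Lemma tsr_mx_inj m n (n_gt0 : (0 < n)%N) (c c' : {ffun 'I_n -> 'F_2})
    (A A' : 'M['F_2]_m) : c (Ordinal n_gt0) = 1 -> c' (Ordinal n_gt0) = 1 ->
  A != 0 -> tsr_mx c A = tsr_mx c' A' -> (c, A) = (c', A').
Proof.
move=> c1 c'1 A0 /eq_mxblockP eq_blk.
have lt_n : (n.-1 < n)%N by rewrite prednK.
have eq_cA i : c i *: A = c' i *: A'.
  by have := eq_blk i (Ordinal lt_n); rewrite /tsr_block /= prednK // eqxx.
have eqA : A = A' by have := eq_cA (Ordinal n_gt0); rewrite c1 c'1 !scale1r.
congr (_, _) => //; apply/ffunP=> i; have := eq_cA i; rewrite -eqA => /eqP.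
by rewrite -subr_eq0 -scalerBl scaler_eq0 (negPf A0) orbF subr_eq0 => /eqP.
Qed.

(** * The two counts for a fixed g, and their comparison *)

Section Count.

Variables (m n : nat) (m_gt0 : (0 < m)%N) (n_gt0 : (0 < n)%N).
Variables (F : finFieldType) (cF : #|F| = (2 ^ m)%N).
Variables (iota : {rmorphism 'F_2 -> F}) (iotaE : iota =1 of_F2 F).
Local Notation taps := {ffun 'I_n -> 'F_2}.
Local Notation i0 := (Ordinal n_gt0).

Let F_pchar2 : 2%N \in [pchar F].
Proof. by apply: card_finPcharP cF _. Qed.

Lemma tap_poly_neq0 (c : taps) : c i0 = 1 -> tap_poly c != 0.
Proof.
move=> c1; apply/eqP => /(congr1 (fun g : {poly 'F_2} => g`_i0)).
by rewrite coef_tap_poly c1 coef0.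
Qed.

Lemma tap_pencil_coef0 (c : taps) a : c i0 = 1 -> (tap_pencil c iota a)`_0 = a.
Proof.
move=> c1; rewrite coefB coefXn coefZ coef_map (coef_tap_poly c i0) c1 /= rmorph1.
by rewrite mulr1 eq_sym eqn0Ngt n_gt0 sub0r oppr_pchar2.
Qed.

(** The norm of a root is a up to a sign, which characteristic 2 absorbs. *)
Lemma primitive_tap_pencil (c : taps) a : c i0 = 1 ->
  primitive_poly (tap_pencil c iota a) -> primitive_elt a.
Proof.
move=> c1 /primitive_poly_coef0.
by rewrite tap_pencil_coef0 // oppr_pchar2 // expr1n mul1r.
Qed.

Lemma card_TSRP2 : #|TSRP2 m n| =
  \sum_(c : taps | c i0 == 1)
    #|[set A : 'M['F_2]_m | primitive_poly (char_poly (tsr_mx c A))]|.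
Proof.
pose W := [set cA : taps * 'M['F_2]_m | (cA.1 i0 == 1)
            && primitive_poly (char_poly (tsr_mx cA.1 cA.2))].
transitivity #|W|.
  have -> : TSRP2 m n = [set tsr_mx cA.1 cA.2 | cA in W].
    apply/setP => T; rewrite inE; apply/andP/imsetP => [[]|[[c A]]].
      case/existsP=> c /existsP[A /eqP->] prim; exists (c, A) => //.
      by rewrite inE /= prim andbT (primitive_tsr_mx n_gt0 m_gt0 prim).1.
    rewrite inE /= => /andP[_ prim] ->; split=> //.
    by apply/existsP; exists c; apply/existsP; exists A.
  apply: card_in_imset => -[c A] [c' A']; rewrite !inE /=.
  move=> /andP[/eqP c1 prim] /andP[/eqP c'1 _].
  exact: tsr_mx_inj c1 c'1 (primitive_tsr_mx n_gt0 m_gt0 prim).2.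
rewrite -sum1_card; under [RHS]eq_bigr do rewrite -sum1_card.
by rewrite pair_big_dep; apply: eq_bigl => -[c A]; rewrite !inE.
Qed.

(** The pair (c, a) is recovered from X^n - a g: the constant coefficient is a, because g(0) = 1,
    and dividing the others by a gives c. *)
Lemma card_P2 : #|P2 F n| =
  \sum_(c : taps | c i0 == 1)
    #|[set a : F | primitive_poly (tap_pencil c iota a)]|.
Proof.
pose S := [set ca : taps * F | (ca.1 i0 == 1)
            && primitive_poly (tap_pencil ca.1 iota ca.2)].
transitivity #|S|.
  have npE (c : taps) a :
      npolyp n.+1 (tap_pencil c iota a) = tap_pencil c iota a :> {poly F}.
    by rewrite npolypK // (tap_pencil_monic c iota a).2.
  have -> : P2 F n = [set npolyp n.+1 (tap_pencil ca.1 iota ca.2) | ca in S].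
    apply/setP => p; rewrite inE; apply/and3P/imsetP => [[]|[[c a]]].
      move=> sp prim /existsP[mu /existsP[g /and3P[gmu g1 /eqP pE]]].
      pose c : taps := [ffun i : 'I_n => (polyn g)`_i].
      have pcE : polyn p = tap_pencil c iota mu.
        rewrite pE /tap_pencil tap_polyK ?size_npoly //.
        by congr ('X^n - _ *: _); apply: eq_map_poly => b; rewrite iotaE.
      exists (c, mu) => /=; last by apply/val_inj; rewrite /= npE.
      by rewrite inE /= ffunE -pcE prim andbT -horner_coef0.
    rewrite inE /= => /andP[/eqP c1 prim] ->; rewrite npE; split=> //.
      by rewrite (tap_pencil_monic c iota a).2.
    apply/existsP; exists a; apply/existsP; exists (npolyp n (tap_poly c)).
    rewrite (primitive_tap_pencil c1 prim) npolypK ?size_tap_poly //.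
    rewrite horner_coef0 (coef_tap_poly c i0) c1 eqxx /=; apply/eqP.
    by congr ('X^n - _ *: _); apply: eq_map_poly => b; rewrite iotaE.
  apply: card_in_imset => -[c a] [c' a']; rewrite !inE /=.
  move=> /andP[/eqP c1 prim] /andP[/eqP c'1 _] /(congr1 val) /=.
  rewrite !npE => eq_p.
  have eq_a : a = a' by rewrite -(tap_pencil_coef0 a c1) eq_p tap_pencil_coef0.
  have a0 := primitive_elt_neq0 (primitive_tap_pencil c1 prim).
  congr (_, _) => //; apply/ffunP => i.
  have := congr1 (fun p : {poly F} => p`_i) eq_p; rewrite -eq_a !coefB.
  move=> /addrI/oppr_inj.
  by rewrite !coefZ !coef_map !coef_tap_poly => /(mulfI a0)/fmorph_inj.
rewrite -sum1_card; under [RHS]eq_bigr do rewrite -sum1_card.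
by rewrite pair_big_dep; apply: eq_bigl => -[c A]; rewrite !inE.
Qed.

Lemma card_primitive_tsr_mx (c : taps) : c i0 = 1 ->
  (m * #|[set A : 'M['F_2]_m | primitive_poly (char_poly (tsr_mx c A))]|
     * (2 ^ m).-1
   = #|[set a : F | primitive_poly (tap_pencil c iota a)]|
     * #|[set P : 'M['F_2]_m | P \in unitmx]|)%N.
Proof.
move=> c1; have g0 := tap_poly_neq0 c1; have c2 : #|'F_2| = 2%N by rewrite card_Fp.
have cF2 : #|F| = (#|'F_2| ^ m)%N by rewrite c2.
set W := [set A | _]; set S := [set a | _].
have WE A : (A \in W) = primitive_poly (tap_homog c (char_poly A)).
  by rewrite inE char_poly_tsr_homog.
have WSE (A : 'M_m) a :
    root (map_poly iota (char_poly A)) a -> (A \in W) = (a \in S).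
  move=> ra; rewrite WE inE.
  apply: (primitive_tap_homogE n_gt0 g0 m_gt0 cF _ _ ra).
    exact: char_poly_monic.
  exact: size_char_poly.
(* Each A in W has exactly m eigenvalues in F, its characteristic polynomial being irreducible of
   degree m. *)
have -> : (m * #|W| =
    \sum_(A in W) #|[set a | root (map_poly iota (char_poly A)) a]|)%N.
  rewrite mulnC -sum_nat_const; apply: eq_bigr => A; rewrite WE.
  have hm := char_poly_monic A; have hs := size_char_poly A.
  case/primitive_polyP=> -[H_irr _] _ _.
  have h_irr : irreducible_poly (char_poly A).
    by apply: (irreducible_tap_homog n_gt0 g0 hm _ H_irr); rewrite hs ltnS.
  by rewrite (@card_irreducible_roots _ _ iota) ?hs.
under eq_bigr do rewrite -sum1_card.
(* The pairs (A, a) are now grouped by a; membership of A in W and of a in S are equivalent for such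
   a pair. *)
rewrite (exchange_big_dep (mem S)) /= => [|A a AW]; last first.
  by rewrite inE => ra; rewrite -(WSE A).
rewrite big_distrl -sum_nat_const; apply: eq_bigr => a aS /=.
have [h [h_mon h_irr sh ha]] : exists h, [/\ h \is monic,
    irreducible_poly h, size h = m.+1 & root (map_poly iota h) a].
  apply: exists_minimal_polynomial => //; apply: primitive_tap_pencil c1 _.
  by move: aS; rewrite inE.
have -> : (\sum_(A in W | a \in [set a | root (map_poly iota (char_poly A)) a]) 1
    = #|[set A : 'M['F_2]_m | char_poly A == h]|)%N.
  rewrite sum1dep_card; congr #|pred_of_set _|; apply/setP => A; rewrite !inE.
  apply/idP/idP => [/andP[_ ra]|/eqP hA].
    by rewrite (irreducible_root_unique h_irr h_mon _ _ ha ra)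
      ?char_poly_monic ?size_char_poly.
  have ra : root (map_poly iota (char_poly A)) a by rewrite hA.
  by rewrite ra andbT; have := WSE A a ra; rewrite aS inE => ->.
(* The Krylov count is stated for matrices of successor dimension. *)
case: (m) m_gt0 sh => // m' _ sh'.
by rewrite -(card_char_poly_eq h_mon h_irr sh') c2.
Qed.

End Count.

Lemma card_GL (R : finComUnitRingType) m :
  #|('GL_m.+1[R])%g| = #|[set P : 'M[R]_m.+1 | P \in unitmx]|.
Proof. by rewrite cardsT card_sub cardsE; apply: eq_card => P; rewrite !inE. Qed.

Theorem theorem3p5 (m n : nat) (hm : (2 <= m)%N) (hn : (1 <= n)%N)
    (F : finFieldType) (hF : #|F| = (2 ^ m)%N) :
  (#|TSRP2 m n|)%:R =
  (#|P2 F n|)%:R / m%:R * ((#|('GL_m[ 'F_2 ])%g|)%:R / (2%:R ^+ m - 1)) :> rat.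
Proof.
have m_gt0 : (0 < m)%N := ltnW hm.
have [iota iotaE] := of_F2_rmorphism (card_finPcharP hF isT).
have m0 : m%:R != 0 :> rat by rewrite pnatr_eq0 -lt0n.
have dE : 2%:R ^+ m - 1 = (2 ^ m).-1%:R :> rat.
  by rewrite -subn1 natrB ?expn_gt0 // natrX.
have d0 : (2 ^ m).-1%:R != 0 :> rat.
  by rewrite pnatr_eq0 -lt0n ltn_predRL (@leq_pexp2l 2 1).
(* Cleared of denominators, the formula is an identity between naturals, proved separately for each
   c with c_0 = 1 and summed. *)
have key : (m * #|TSRP2 m n| * (2 ^ m).-1 = #|P2 F n| * #|('GL_m['F_2])%g|)%N.
  have -> : #|('GL_m['F_2])%g| = #|[set P : 'M['F_2]_m | P \in unitmx]|.
    by case: (m) m_gt0 => // m' _; rewrite card_GL.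
  rewrite (card_TSRP2 m_gt0 hn) (card_P2 hn hF iotaE).
  rewrite big_distrr !big_distrl; apply: eq_bigr => c /eqP c1.
  exact: (card_primitive_tsr_mx m_gt0 hF).
rewrite dE mulf_div; apply: (canRL (mulfK _)); first by rewrite mulf_neq0.
by rewrite -!natrM -key mulnA [(_ * m)%N]mulnC.
Qed.
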